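(* Let $M$ be an $n$-dimensional Riemannian manifold, $n\ge 4$, with metric $g_{ij}$ and Riemann curvature tensor $R_{jkl}{}^m$. Let $b_{kl}$ be a symmetric $(0,2)$ tensor field on $M$ satisfying the algebraic equation $$ b_{im} R_{jkl}{}^m+b_{jm} R_{kil}{}^m+b_{km} R_{ijl}{}^m=0 $$ for all indices $i,j,k,l$. Then, for every $x\in M$ and for arbitrary eigenvalues $\lambda$ and $\mu$ of the operator $b_i{}^j(x)$ on $T_xM$, with eigenspaces $V_\lambda$ and $V_\mu$ in $T_xM$, the subspace $V_\lambda\wedge V_\mu\subseteq \Lambda^2 T_xM$ is invariant under the action of the curvature operator $R_x$.
   Context: $\nabla$ is the Riemannian (Levi-Civita) connection of $g_{ij}$; indices are raised and lowered with $g$, and repeated indices are summed. The Riemann tensor convention is $[\nabla_i,\nabla_j]v_k=R_{ijk}{}^m v_m$, so that $[\nabla_i,\nabla_j]b_{kl}=R_{ijk}{}^m b_{ml}+R_{ijl}{}^m b_{km}$; also $R_{ijkl}=R_{ijk}{}^m g_{ml}$ and the Ricci tensor is $R_{kl}=-R_{mkl}{}^m$. The operator $b_i{}^j(x)=b_{im}(x)g^{mj}(x)$ is the $g$-self-adjoint endomorphism of $T_xM$ associated with $b$; its eigenvalues and eigenvectors are those of this endomorphism. $V_\lambda\wedge V_\mu$ is the linear span of all $X\wedge Y$ with $X\in V_\lambda$, $Y\in V_\mu$ (the eigenvalues $\lambda,\mu$ may coincide). The curvature operator $R_x:\Lambda^2T_xM\to\Lambda^2T_xM$ is the linear map on bivectors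 $\omega^{ij}=-\omega^{ji}$ given, up to a nonzero constant factor irrelevant for invariance, by $(R_x\omega)^{kl}=R_{ij}{}^{kl}\omega^{ij}$. *)

(* Defs.v *)
(* Tensors are handled through their components in the charts of a smooth
   atlas: a component function takes the coordinates y : 'rV[R]_n of a point,
   and only its values on the image of the chart matter. *)
From HB Require Import structures.
From mathcomp Require Export all_boot all_order all_algebra.
From mathcomp Require Export all_classical all_reals all_analysis.
Export numFieldNormedType.Exports.
Export Order.TTheory GRing.Theory Num.Theory.

Set Implicit Arguments.
Unset Strict Implicit.
Unset Printing Implicit Defensive.

Local Open Scope classical_set_scope.
Local Open Scope ring_scope.

Definition partial (R : realType) (n : nat) (i : 'I_n) (f : 'rV[R]_n -> R)
  : 'rV[R]_n -> R := fun y => 'D_(delta_mx 0 i) f y.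

(* C^oo on U: partial derivatives of all orders exist and are continuous. *)
Definition smooth_on (R : realType) (n : nat) (U : set 'rV[R]_n)
    (f : 'rV[R]_n -> R) : Prop :=
  forall (s : seq 'I_n) (y : 'rV[R]_n), U y ->
    {for y, continuous (foldr (@partial R n) f s)} /\
    forall i : 'I_n, derivable (foldr (@partial R n) f s) y (delta_mx 0 i).

(* [ccoord a] and [cpoint a] are a homeomorphism and its inverse between the
   open sets [cdom a] and [cimg a]; their values elsewhere are irrelevant. *)
Record manifold (R : realType) (n : nat) := Manifold {
  points :> topologicalType;
  points_hausdorff : hausdorff_space points;
  points_second_countable : @second_countable points;
  chart : Type;
  cdom : chart -> set points;
  ccoord : chart -> points -> 'rV[R]_n;
  cpoint : chart -> 'rV[R]_n -> points;
  cimg := fun a : chart => [set ccoord a x | x in cdom a];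
  cdom_cover : forall x : points, exists a : chart, cdom a x;
  cdom_open : forall a : chart, open (cdom a);
  cimg_open : forall a : chart, open (cimg a);
  ccoordK : forall (a : chart) (x : points),
    cdom a x -> cpoint a (ccoord a x) = x;
  ccoord_continuous : forall (a : chart) (x : points),
    cdom a x -> {for x, continuous (ccoord a)};
  cpoint_continuous : forall (a : chart) (y : 'rV[R]_n),
    cimg a y -> {for y, continuous (cpoint a)};
  transition_smooth : forall (a b : chart) (k : 'I_n),
    smooth_on [set ccoord a x | x in cdom a `&` cdom b]
      (fun y => ccoord b (cpoint a y) 0 k)
}.

(* Smooth (0,2) tensor fields.  The entry (i, k) of the jacobian below is the
   i-th partial derivative of the k-th component of the change of charts, so
   that T^a_ij = (d z^k / d y^i) (d z^l / d y^j) T^b_kl. *)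
Record tensor02 (R : realType) (n : nat) (M : manifold R n) := Tensor02 {
  comp02 :> chart M -> 'rV[R]_n -> 'M[R]_n;
  comp02_smooth : forall (a : chart M) (i j : 'I_n),
    smooth_on (cimg a) (fun y => comp02 a y i j);
  comp02_change : forall (a b : chart M) (x : M), cdom a x -> cdom b x ->
    let J := jacobian (fun y => ccoord b (cpoint a y)) (ccoord a x) in
    comp02 a (ccoord a x) = J *m comp02 b (ccoord b x) *m J^T
}.

Definition symmetric02 (R : realType) (n : nat) (M : manifold R n)
    (T : tensor02 M) : Prop :=
  forall (a : chart M) (y : 'rV[R]_n), cimg a y ->
    forall i j : 'I_n, T a y i j = T a y j i.

Record metric (R : realType) (n : nat) (M : manifold R n) := Metric {
  metric_tensor :> tensor02 M;
  metric_sym : symmetric02 metric_tensor;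
  metric_pos : forall (a : chart M) (y : 'rV[R]_n), cimg a y ->
    forall v : 'rV[R]_n, v != 0 -> 0 < (v *m metric_tensor a y *m v^T) 0 0
}.

(* Below, G : 'rV[R]_n -> 'M[R]_n stands for the components g_ij of the
   metric in one chart, and invmx (G y) for g^ij. *)

(* Gamma^k_ij *)
Definition christoffel (R : realType) (n : nat) (G : 'rV[R]_n -> 'M[R]_n)
    (k i j : 'I_n) (y : 'rV[R]_n) : R :=
  2^-1 * \sum_(m < n) invmx (G y) k m *
    (partial i (fun z => G z j m) y + partial j (fun z => G z i m) y
     - partial m (fun z => G z i j) y).

(* nabla_j v_k *)
Definition nabla1 (R : realType) (n : nat) (G : 'rV[R]_n -> 'M[R]_n)
    (v : 'I_n -> 'rV[R]_n -> R) (j k : 'I_n) (y : 'rV[R]_n) : R :=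
  partial j (v k) y - \sum_(p < n) christoffel G p j k y * v p y.

(* nabla_i T_jk *)
Definition nabla2 (R : realType) (n : nat) (G : 'rV[R]_n -> 'M[R]_n)
    (T : 'I_n -> 'I_n -> 'rV[R]_n -> R) (i j k : 'I_n) (y : 'rV[R]_n) : R :=
  partial i (T j k) y
  - \sum_(p < n) christoffel G p i j y * T p k y
  - \sum_(p < n) christoffel G p i k y * T j p y.

(* R_ijk^m, read off from [nabla_i, nabla_j] v_k = R_ijk^m v_m by taking for v
   the coordinate covector field dx^m, whose components are constant:
   R_ijk^m = d_j Gamma^m_ik - d_i Gamma^m_jk
             + Gamma^p_ik Gamma^m_jp - Gamma^p_jk Gamma^m_ip. *)
Definition riemann (R : realType) (n : nat) (G : 'rV[R]_n -> 'M[R]_n)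
    (i j k m : 'I_n) (y : 'rV[R]_n) : R :=
  let dx : 'I_n -> 'rV[R]_n -> R := fun q _ => (q == m)%:R in
  nabla2 G (nabla1 G dx) i j k y - nabla2 G (nabla1 G dx) j i k y.

(* R_ij^kl = g^kp R_ijp^l *)
Definition riemann_up (R : realType) (n : nat) (G : 'rV[R]_n -> 'M[R]_n)
    (i j k l : 'I_n) (y : 'rV[R]_n) : R :=
  \sum_(p < n) invmx (G y) k p * riemann G i j p l y.

(* A tangent vector at a point is given by its row of components X^i in a
   chart, and a bivector by the antisymmetric matrix of its components w^ij. *)

Definition curvature_operator (R : realType) (n : nat)
    (G : 'rV[R]_n -> 'M[R]_n) (y : 'rV[R]_n) (w : 'M[R]_n) : 'M[R]_n :=
  \matrix_(k, l) \sum_(i < n) \sum_(j < n) riemann_up G i j k l y * w i j.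

(* The matrix of b_i^j = b_im g^mj; it acts on rows, (X^i) |-> (X^i b_i^j), so
   that MathComp's [eigenvalue] and [eigenspace], which use row vectors, are
   those of the endomorphism of the tangent space. *)
Definition mixed02 (R : realType) (n : nat) (G B : 'rV[R]_n -> 'M[R]_n)
    (y : 'rV[R]_n) : 'M[R]_n := B y *m invmx (G y).

(* (X wedge Y)^ij = X^i Y^j - X^j Y^i *)
Definition wedge (R : realType) (n : nat) (X Y : 'rV[R]_n) : 'M[R]_n :=
  X^T *m Y - Y^T *m X.

(* The linear span of the X wedge Y with X, Y in the row spaces of V, W. *)
Definition wedge_span (R : realType) (n : nat) (V W : 'M[R]_n)
  : set 'M[R]_n :=
  [set w | exists (N : nat) (c : 'I_N -> R) (X Y : 'I_N -> 'rV[R]_n),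
     (forall s : 'I_N, (X s <= V)%MS /\ (Y s <= W)%MS) /\
     w = \sum_(s < N) c s *: wedge (X s) (Y s)].

(* b_im R_jkl^m + b_jm R_kil^m + b_km R_ijl^m = 0 *)
Definition riemann_compatible (R : realType) (n : nat) (M : manifold R n)
    (g : metric M) (b : tensor02 M) : Prop :=
  forall (a : chart M) (y : 'rV[R]_n), cimg a y ->
    forall i j k l : 'I_n,
      \sum_(m < n) (b a y i m * riemann (g a) j k l m y
                    + b a y j m * riemann (g a) k i l m y
                    + b a y k m * riemann (g a) i j l m y) = 0.

(* Main.v *)
Require Import Defs.
From mathcomp Require Import perm ring lra.

(** At a point, write S for the endomorphism attached to b, and let P be the
    components of an element of the tensor product of the eigenspaces of lambda
    and mu, so that P - P^T is the corresponding element of their exterior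
    product.  In matrix form, S^T P = lambda P and P S = mu P
    ([wedge_span_eigenspaceP]).  Contracting the curvature tensor against P in
    the pairs of slots 12, 14 and 24 gives, up to sign, three bilinear forms C, A
    and B in the two remaining vectors.  The first Bianchi identity says A + B + C = 0, and
    the algebraic equation on b, whose free index may be put in any slot thanks
    to the symmetries of the curvature tensor, gives three linear relations
    whose coefficients are lambda, mu, S acting on the first slot and S acting
    on the second slot.  If lambda and mu differ, eliminating A and B yields, with
    s and t for these two actions,

      (s + t - lambda - mu) C = 0   and   (s - lambda) (s - mu) C = 0,

    and so C is the antisymmetrization of a form Q with s Q = lambda Q and
    t Q = mu Q; if lambda = mu, elimination gives s C = t C = lambda C and Q is
    C / 2 ([eigen_splitting]).  Raising both indices turns this into
    membership in the exterior product of the eigenspaces, and C is, up to a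
    factor, the image of P - P^T under the curvature operator.

    The input from geometry is that the Riemann tensor, defined by derivatives
    of the Christoffel symbols in a chart, has the symmetries of an algebraic
    curvature tensor.  The Bianchi identity comes from the symmetry of the
    Christoffel symbols ([riemann_bianchi]); the skew symmetry in the last two
    indices comes from the compatibility of the connection with the metric and
    the equality of the mixed second derivatives of the metric
    ([lower_riemann_skew], [mixed_derivatives_eq]); the symmetry under exchange
    of the two pairs of indices follows algebraically ([pair_symmetry]). *)

Set Implicit Arguments.
Unset Strict Implicit.
Local Open Scope classical_set_scope.
Local Open Scope ring_scope.

(** * Symmetry of second directional derivatives *)

Lemma is_derive_line (R : realType) (V : normedModType R) (f : V -> R)
    (c u : V) (s d : R) : is_derive (s *: u + c) u f d ->
  is_derive s 1 (fun t => f (t *: u + c)) d.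
Proof.
move=> [df dE].
have E : (fun h : R => h^-1 *: (f ((h *: (1 : R) + s) *: u + c) - f (s *: u + c)))
       = (fun h : R => h^-1 *: (f (h *: u + (s *: u + c)) - f (s *: u + c))).
  by apply/funext => h; rewrite addrA -scalerDl scaler1.
split; first by move: df; rewrite /derivable /= E.
by rewrite -dE /derive /= E.
Qed.

Lemma mean_value_line (R : realType) (V : normedModType R) (f fu : V -> R)
    (c u : V) (h : R) : 0 < h ->
  (forall s, 0 <= s <= h -> is_derive (s *: u + c) u f (fu (s *: u + c))) ->
  exists2 s, 0 < s < h & f (h *: u + c) - f c = fu (s *: u + c) * h.
Proof.
move=> h0 df.
have dl s : 0 <= s <= h ->
    is_derive s 1 (fun t => f (t *: u + c)) (fu (s *: u + c)).
  by move=> /df; exact: is_derive_line.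
have [||s] := @MVT R (fun t => f (t *: u + c)) (fun s => fu (s *: u + c)) 0 h h0.
- by move=> s; rewrite in_itv /= => /andP[s0 sh]; apply: dl; rewrite !ltW.
- apply: derivable_within_continuous => s; rewrite in_itv /= => sh.
  by have [] := dl s sh.
- by rewrite in_itv /= scale0r add0r subr0 => sh E; exists s.
Qed.

(** The mean value theorem is used twice: along u for the increment of f in the
    direction v, and then along v for fu.  The left-hand side is symmetric in u
    and v, which is what makes the two orders of derivation comparable. *)
Lemma second_difference (R : realType) (V : normedModType R)
    (f fu fuv : V -> R) (y u v : V) (h : R) : 0 < h ->
  (forall s t, 0 <= s <= h -> 0 <= t <= h ->
    is_derive (s *: u + (t *: v + y)) u f (fu (s *: u + (t *: v + y))) /\
    is_derive (s *: u + (t *: v + y)) v fu (fuv (s *: u + (t *: v + y)))) ->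
  exists s t, [/\ 0 < s < h, 0 < t < h &
    f (h *: u + (h *: v + y)) - f (h *: v + y) - (f (h *: u + y) - f y)
      = fuv (s *: u + (t *: v + y)) * h ^+ 2].
Proof.
move=> h0 df.
pose g z := f (h *: v + z) - f z.
have hh : 0 <= h <= h by rewrite ltW //=.
have h00 : 0 <= (0 : R) <= h by rewrite lexx ltW.
have dshift s : 0 <= s <= h ->
    is_derive (s *: u + y) u (fun z => f (h *: v + z))
      (fu (s *: u + (h *: v + y))).
  move=> sh; have [[d dE] _] := df s h sh hh.
  have E : (fun k : R => k^-1 *: (f (h *: v + (k *: u + (s *: u + y)))
                                   - f (h *: v + (s *: u + y))))
         = (fun k : R => k^-1 *: (f (k *: u + (s *: u + (h *: v + y)))
                                   - f (s *: u + (h *: v + y)))).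
    by apply/funext => k; rewrite !(addrCA (h *: v)).
  split; first by move: d; rewrite /derivable /= E.
  by rewrite -dE /derive /= E.
have dg s : 0 <= s <= h ->
    is_derive (s *: u + y) u g (fu (s *: u + (h *: v + y)) - fu (s *: u + y)).
  move=> sh; have [d _] := df s 0 sh h00.
  rewrite scale0r add0r in d.
  have ds := dshift s sh; exact: is_deriveB.
have [s sh gE] := @mean_value_line R V g
  (fun z => fu (h *: v + z) - fu z) y u h h0
  (fun s sh => eq_rect _ (is_derive (s *: u + y) u g) (dg s sh) _
                 (congr1 (fun z => fu z - _) (addrCA (s *: u) (h *: v) y))).
have sh' : 0 <= s <= h by case/andP: sh => ? ?; rewrite !ltW.
have df2 t : 0 <= t <= h ->
    is_derive (t *: v + (s *: u + y)) v fu (fuv (t *: v + (s *: u + y))).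
  by move=> th; have [_] := df s t sh' th; rewrite (addrCA (s *: u)).
have [t th fE] := @mean_value_line R V fu fuv (s *: u + y) v h h0 df2.
exists s, t; split => //.
rewrite (addrCA (s *: u) (t *: v)) expr2 mulrA -fE -gE /g.
by rewrite (addrCA (h *: v) (h *: u)); ring.
Qed.

(** Both mixed derivatives, evaluated at some points of an arbitrarily small
    parallelogram at y, equal the same second difference quotient of f; by
    continuity they agree at y. *)
Lemma mixed_derivatives_eq (R : realType) (V : normedModType R)
    (f fu fv fuv fvu : V -> R) (y u v : V) :
  (\forall z \near y, [/\ is_derive z u f (fu z), is_derive z v f (fv z),
     is_derive z v fu (fuv z) & is_derive z u fv (fvu z)]) ->
  {for y, continuous fuv} -> {for y, continuous fvu} -> fuv y = fvu y.
Proof.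
move=> df cuv cvu; apply/eqP; rewrite -subr_eq0 -normr_le0; apply/ler_addgt0Pl.
move=> e e0; rewrite addr0.
have e2 : 0 < e / 2 by rewrite divr_gt0.
have /cvgrPdist_lt /(_ _ e2) c1 := cuv.
have /cvgrPdist_lt /(_ _ e2) c2 := cvu.
have := filterI df (filterI c1 c2) => /(_ _ _)/nbhs_ballP[d /= d0 dP].
(* This side keeps the whole parallelogram in the ball of radius d. *)
pose h := d / (`|u| + `|v| + 1).
have k0 : 0 < `|u| + `|v| + 1 by rewrite ltr_wpDl // addr_ge0.
have h0 : 0 < h by rewrite divr_gt0.
have dE : d = h * (`|u| + `|v| + 1) by rewrite /h divfK // gt_eqF.
move: h h0 dE => h h0 dE.
have box s t : 0 <= s <= h -> 0 <= t <= h -> ball y d (s *: u + (t *: v + y)).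
  move=> /andP[s0 sh] /andP[t0 th]; rewrite -ball_normE /ball_ /=.
  rewrite addrA opprD addrCA subrr addr0 normrN.
  apply: (le_lt_trans (ler_normD _ _)); rewrite !normrZ !ger0_norm //.
  have := ler_wpM2r (normr_ge0 u) sh; have := ler_wpM2r (normr_ge0 v) th.
  by rewrite dE; lra.
have open_box s : 0 < s < h -> 0 <= s <= h.
  by case/andP => ? ?; rewrite !ltW.
have box1 s t : 0 <= s <= h -> 0 <= t <= h ->
    is_derive (s *: u + (t *: v + y)) u f (fu (s *: u + (t *: v + y))) /\
    is_derive (s *: u + (t *: v + y)) v fu (fuv (s *: u + (t *: v + y))).
  by move=> sh th; have [[]] := dP _ (box s t sh th).
have box2 s t : 0 <= s <= h -> 0 <= t <= h ->
    is_derive (s *: v + (t *: u + y)) v f (fv (s *: v + (t *: u + y))) /\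
    is_derive (s *: v + (t *: u + y)) u fv (fvu (s *: v + (t *: u + y))).
  by move=> sh th; have [[]] := dP _ (box t s th sh); rewrite addrCA.
have [s [t [sh th E1]]] := @second_difference _ _ _ _ _ _ _ _ _ h0 box1.
have [s' [t' [s'h t'h E2]]] := @second_difference _ _ _ _ _ _ _ _ _ h0 box2.
have [_ [b1 _]] := dP _ (box s t (open_box _ sh) (open_box _ th)).
have [_ [_]] := dP _ (box t' s' (open_box _ t'h) (open_box _ s'h)).
rewrite addrCA => b2.
have h2 : h ^+ 2 != 0 by rewrite expf_neq0 // gt_eqF.
have E : fuv (s *: u + (t *: v + y)) = fvu (s' *: v + (t' *: u + y)).
  by apply: (mulIf h2); rewrite -E1 -E2 (addrCA (h *: v)); ring.
move: b1 b2; rewrite E => b1 b2; apply: ltW.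
by move: b1 b2; rewrite !ltr_norml; lra.
Qed.

(** * Derivatives of sums, determinants and inverse matrices *)

Section BigDerivatives.
Variables (R : realType) (V : normedModType R) (y v : V).

Lemma derivable_ext (f g : V -> R) : f =1 g -> derivable f y v -> derivable g y v.
Proof. by move=> /funext ->. Qed.

Lemma derivable_mul (f g : V -> R) : derivable f y v -> derivable g y v ->
  derivable (fun z => f z * g z) y v.
Proof. exact: derivableM. Qed.

Lemma derivable_mull (c : R) (g : V -> R) : derivable g y v ->
  derivable (fun z => c * g z) y v.
Proof. exact: (derivable_mul (derivable_cst c y v)). Qed.

Lemma is_derive_bigsum (I : Type) (r : seq I) (P : pred I)
    (F : I -> V -> R) (dF : I -> R) :
  (forall i, is_derive y v (F i) (dF i)) ->
  is_derive y v (fun z => \sum_(i <- r | P i) F i z) (\sum_(i <- r | P i) dF i).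
Proof.
move=> FdF; elim: r => [|i r IH].
  rewrite big_nil (_ : (fun=> _) = cst 0); first exact: is_derive_cst.
  by apply/funext => z; rewrite big_nil.
rewrite big_cons (_ : (fun=> _) = (if P i then F i else cst 0) +
   (fun z => \sum_(i <- r | P i) F i z)); last first.
  by apply/funext => z; rewrite big_cons /= fctE; case: (P i) => //=; rewrite add0r.
case: (P i); first exact: is_deriveD.
by rewrite -[X in is_derive _ _ _ X]add0r; apply: is_deriveD.
Qed.

Lemma derivable_bigsum (I : Type) (r : seq I) (P : pred I) (F : I -> V -> R) :
  (forall i, derivable (F i) y v) ->
  derivable (fun z => \sum_(i <- r | P i) F i z) y v.
Proof. by move=> dF; apply: ex_derive; apply: is_derive_bigsum. Qed.

Lemma derivable_bigprod (I : Type) (r : seq I) (F : I -> V -> R) :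
  (forall i, derivable (F i) y v) ->
  derivable (fun z => \prod_(i <- r) F i z) y v.
Proof.
move=> dF; elim: r => [|i r IH].
  rewrite (_ : (fun=> _) = cst 1); first exact: derivable_cst.
  by apply/funext => z; rewrite big_nil.
rewrite (_ : (fun=> _) = F i * (fun z => \prod_(i <- r) F i z)).
  exact: derivableM (dF i) IH.
by apply/funext => z; rewrite big_cons.
Qed.

Lemma derivable_det (m : nat) (M : V -> 'M[R]_m) :
  (forall i j, derivable (fun z => M z i j) y v) ->
  derivable (fun z => \det (M z)) y v.
Proof.
move=> dM; rewrite /determinant.
have dP (s : {perm 'I_m}) :
    derivable (fun z => (-1) ^+ s * \prod_i M z i (s i)) y v.
  apply: derivable_mull.
  exact: derivable_bigprod.
exact: derivable_bigsum.
Qed.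

(** By Cramer's rule, which describes [invmx] only where M is invertible, hence
    the invertibility assumption on a whole neighbourhood. *)
Lemma derivable_invmx (m : nat) (M : V -> 'M[R]_m) :
  (\forall z \near y, M z \in unitmx) ->
  (forall i j, derivable (fun z => M z i j) y v) ->
  forall i j, derivable (fun z => invmx (M z) i j) y v.
Proof.
move=> Mu dM i j.
apply: (@near_eq_derivable _ _ _ (fun z => (\det (M z))^-1 * (\adj (M z)) i j)).
  move: Mu; apply: filterS => z Mz.
  by rewrite /invmx Mz [in RHS]mxE.
apply: derivable_mul.
  apply: derivableV; last exact: derivable_det.
  by have := nbhs_singleton Mu; rewrite unitmxE unitfE.
rewrite (_ : (fun=> _) = fun z => (-1) ^+ (j + i) * \det (row' j (col' i (M z)))).
  apply: derivable_mull.
  apply: derivable_det => k l.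
  by rewrite (_ : (fun=> _) = fun z => M z (lift j k) (lift i l)) //;
     apply/funext => z; rewrite !mxE.
by apply/funext => z; rewrite mxE.
Qed.

End BigDerivatives.

(** * The Riemann tensor of a metric in a chart *)

(** The skew symmetry in the last two indices is a computation with the values
    at one point of the following quantities: the metric G, the Christoffel
    symbols c and c1 of the second and first kind, the derivatives dc of c, and
    the first and second derivatives dg and ddg of the metric.  With all indices
    lowered, the curvature is a combination of second derivatives of the metric
    plus a term Q quadratic in c; in the symmetrization, the first part cancels
    because second derivatives commute and the second because Q is a symmetric
    bilinear expression in its two pairs of indices. *)
Lemma lowered_curvature_skew (R : realFieldType) (n : nat) (G : 'M[R]_n)
    (c c1 : 'I_n -> 'I_n -> 'I_n -> R) (dc : 'I_n -> 'I_n -> 'I_n -> 'I_n -> R)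
    (dg : 'I_n -> 'I_n -> 'I_n -> R)
    (ddg r : 'I_n -> 'I_n -> 'I_n -> 'I_n -> R) :
  (forall a b, G a b = G b a) ->
  (forall l a b, \sum_m G l m * c m a b = c1 l a b) ->
  (forall h m l, dg h m l = c1 m h l + c1 l h m) ->
  (forall h l a b, \sum_m dc h m a b * G m l =
     2^-1 * (ddg h a b l + ddg h b a l - ddg h l a b)
     - \sum_m c m a b * dg h m l) ->
  (forall h k a b, ddg h k a b = ddg k h a b) ->
  (forall h k a b, ddg h k a b = ddg h k b a) ->
  (forall i j k m, r i j k m = dc j m i k - dc i m j k
     + \sum_p c p i k * c m j p - \sum_p c p j k * c m i p) ->
  forall i j k l, \sum_m r i j l m * G m k = - \sum_m r i j k m * G m l.
Proof.
move=> Gsym c1E dgE dcE ddgC ddgS rE i j k l.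
pose Q a b h d := \sum_p c p a b * c1 p h d.
have QS a b h d : Q a b h d = Q h d a b.
  rewrite /Q; under eq_bigr do rewrite -c1E mulr_sumr.
  rewrite exchange_big; apply: eq_bigr => q _ /=.
  rewrite -c1E mulr_sumr; apply: eq_bigr => p _.
  by rewrite (Gsym p q); ring.
have quad a b h d :
    \sum_m (\sum_p c p a b * c m h p) * G m d = \sum_p c p a b * c1 d h p.
  under eq_bigr do rewrite mulr_suml.
  rewrite exchange_big; apply: eq_bigr => p _ /=.
  rewrite -c1E mulr_sumr; apply: eq_bigr => m _.
  by rewrite (Gsym m d); ring.
have cdg a b h d :
    \sum_p c p a b * dg h p d = Q a b h d + \sum_p c p a b * c1 d h p.
  by rewrite -big_split; apply: eq_bigr => p _; rewrite dgE mulrDr.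
have lower a b h d : \sum_m r a b h m * G m d =
    2^-1 * (ddg b h a d - ddg b d a h) - 2^-1 * (ddg a h b d - ddg a d b h)
    - Q a h b d + Q b h a d.
  under eq_bigr do rewrite rE mulrBl mulrDl mulrBl.
  rewrite sumrB big_split sumrB /= !dcE !quad !cdg (ddgC b a); ring.
rewrite !lower (QS i l) (QS j l); ring.
Qed.

(** The components, on an open set of coordinates, of a possibly indefinite
    metric. *)
Record chart_metric (R : realType) (n : nat) (U : set 'rV[R]_n)
    (G : 'rV[R]_n -> 'M[R]_n) : Prop := ChartMetric {
  chart_metric_open : open U;
  chart_metric_smooth : forall i j, smooth_on U (fun z => G z i j);
  chart_metric_sym : forall z, U z -> (G z)^T = G z;
  chart_metric_unit : forall z, U z -> G z \in unitmx
}.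

(** Christoffel symbols of the first kind: the free index l is lowered. *)
Definition christoffel_first (R : realType) (n : nat) (G : 'rV[R]_n -> 'M[R]_n)
    (l i j : 'I_n) (y : 'rV[R]_n) : R :=
  2^-1 * (partial i (fun z => G z j l) y + partial j (fun z => G z i l) y
          - partial l (fun z => G z i j) y).

Section ChartMetric.
Variables (R : realType) (n : nat) (U : set 'rV[R]_n) (G : 'rV[R]_n -> 'M[R]_n).
Hypothesis hG : chart_metric U G.

Local Notation e i := (delta_mx 0 i : 'rV[R]_n).
Local Notation g i j := (fun z : 'rV[R]_n => G z i j).
Local Notation Gam := (christoffel G).
Local Notation Gam1 := (christoffel_first G).

Lemma near_chart (y : 'rV[R]_n) : U y -> \forall z \near y, U z.
Proof. by move=> Uy; apply: open_nbhs_nbhs; split=> //; case: hG. Qed.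

Lemma smooth_derivable (f : 'rV[R]_n -> R) i y :
  smooth_on U f -> U y -> is_derive y (e i) f (partial i f y).
Proof. by move=> fs Uy; apply/derivableP; have [_] := fs [::] y Uy; exact. Qed.

Lemma smooth_partial (f : 'rV[R]_n -> R) i : smooth_on U f -> smooth_on U (partial i f).
Proof. by move=> fs s y Uy; have := fs (rcons s i) y Uy; rewrite foldr_rcons. Qed.

Lemma smooth_partialC (f : 'rV[R]_n -> R) i j y : smooth_on U f -> U y ->
  partial i (partial j f) y = partial j (partial i f) y.
Proof.
move=> fs Uy.
apply: (@mixed_derivatives_eq _ _ f (partial j f) (partial i f) _ _ y (e j) (e i)).
- apply: filterS (near_chart Uy) => z Uz.
  have fsi := smooth_partial i fs; have fsj := smooth_partial j fs.
  split; [exact: smooth_derivable fs Uz|exact: smooth_derivable fs Uz| |].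
    exact: smooth_derivable fsj Uz.
  exact: smooth_derivable fsi Uz.
- by have [] := fs [:: i; j] y Uy.
- by have [] := fs [:: j; i] y Uy.
Qed.

Lemma metric_entry_sym z i j : U z -> G z i j = G z j i.
Proof. by move=> /(chart_metric_sym hG) /matrixP/(_ j i); rewrite mxE. Qed.

Lemma partial_metric_sym z k i j : U z ->
  partial k (g i j) z = partial k (g j i) z.
Proof.
move=> Uz; apply: near_eq_derive; apply: filterS (near_chart Uz) => x.
exact: metric_entry_sym.
Qed.

Lemma partial2_metric_sym z h k i j : U z ->
  partial h (partial k (g i j)) z = partial h (partial k (g j i)) z.
Proof.
move=> Uz; apply: near_eq_derive; apply: filterS (near_chart Uz) => x.
exact: partial_metric_sym.
Qed.

Lemma christoffel_sym z m i j : U z -> Gam m i j z = Gam m j i z.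
Proof.
move=> Uz; rewrite /christoffel; congr (_ * _); apply: eq_bigr => p _.
by rewrite (partial_metric_sym p i j Uz) (addrC (partial j _ z)).
Qed.

Lemma lower_christoffel z l i j : U z ->
  \sum_m G z l m * Gam m i j z = Gam1 l i j z.
Proof.
move=> Uz; pose v := \col_m (2^-1 *
  (partial i (g j m) z + partial j (g i m) z - partial m (g i j) z)).
have -> : Gam1 l i j z = (G z *m (invmx (G z) *m v)) l 0.
  by rewrite mulKVmx ?(chart_metric_unit hG) // mxE.
rewrite mxE; apply: eq_bigr => m _; congr (_ * _).
rewrite mxE /christoffel mulr_sumr; apply: eq_bigr => p _.
by rewrite mxE; ring.
Qed.

(** The metric is parallel for the Levi-Civita connection. *)
Lemma partial_metric z i m l : U z ->
  partial i (g m l) z = Gam1 m i l z + Gam1 l i m z.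
Proof.
move=> Uz; rewrite /christoffel_first.
rewrite (partial_metric_sym i l m Uz) (partial_metric_sym l i m Uz).
rewrite (partial_metric_sym m i l Uz); lra.
Qed.

Lemma is_derive_christoffel_first y h l i j : U y ->
  is_derive y (e h) (Gam1 l i j)
    (2^-1 * (partial h (partial i (g j l)) y + partial h (partial j (g i l)) y
             - partial h (partial l (g i j)) y)).
Proof.
move=> Uy; rewrite /christoffel_first.
have dd k a b : is_derive y (e h) (partial k (g a b)) (partial h (partial k (g a b)) y).
  by apply: smooth_derivable => //; apply/smooth_partial/chart_metric_smooth.
apply: (@is_deriveZ _ _ _ (_ + _ - _)).
Qed.

Lemma derivable_christoffel y h m i j : U y -> derivable (Gam m i j) y (e h).
Proof.
move=> Uy; apply: derivable_mull.
have d p : derivable (fun z => invmx (G z) m p * (2 * Gam1 p i j z)) y (e h).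
  apply: derivable_mul.
    apply: derivable_invmx => [|a b].
      apply: filterS (near_chart Uy) => z; exact: chart_metric_unit.
    by have [] := smooth_derivable h (chart_metric_smooth hG a b) Uy.
  apply: derivable_mull.
  by have [] := is_derive_christoffel_first h p i j Uy.
have := @derivable_bigsum _ _ _ _ _ (index_enum _) xpredT _ d; apply: derivable_ext => z.
apply: eq_bigr => p _.
by rewrite /christoffel_first; field.
Qed.

Lemma partial_cst (i : 'I_n) (c : R) y : partial i (fun=> c) y = 0.
Proof. exact: derive_cst. Qed.

Lemma partialN (f : 'rV[R]_n -> R) i y : derivable f y (e i) ->
  partial i (- f) y = - partial i f y.
Proof. by move=> df; rewrite /partial deriveN. Qed.

(** Obtained by differentiating [lower_christoffel]; the derivative of the inverse
    metric, hidden in that of the Christoffel symbol, never appears. *)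
Lemma lower_partial_christoffel y h l i j : U y ->
  \sum_m partial h (Gam m i j) y * G y m l =
  2^-1 * (partial h (partial i (g j l)) y + partial h (partial j (g i l)) y
             - partial h (partial l (g i j)) y)
  - \sum_m Gam m i j y * partial h (g m l) y.
Proof.
move=> Uy.
have [_ <-] := is_derive_christoffel_first h l i j Uy.
have d m : is_derive y (e h) (fun z => G z m l * Gam m i j z)
    (G y m l * partial h (Gam m i j) y + Gam m i j y * partial h (g m l) y).
  apply: (@is_deriveM _ _ (g m l)).
    by apply: smooth_derivable => //; exact: chart_metric_smooth.
  exact/derivableP/derivable_christoffel.
have := @is_derive_bigsum _ _ _ _ _ (index_enum _) xpredT _ _ d.
have nE : \near y, \sum_m G y m l * Gam m i j y = Gam1 l i j y.
  apply: filterS (near_chart Uy) => z Uz; rewrite -lower_christoffel //.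
  by apply: eq_bigr => m _; rewrite (metric_entry_sym m l Uz).
move=> /(near_eq_is_derive nE)[_ ->]; rewrite big_split /=.
by rewrite addrK; apply: eq_bigr => m _; rewrite mulrC.
Qed.

Lemma riemannE y i j k m : U y ->
  riemann G i j k m y = partial j (Gam m i k) y - partial i (Gam m j k) y
    + \sum_p Gam p i k y * Gam m j p y - \sum_p Gam p j k y * Gam m i p y.
Proof.
move=> Uy; rewrite /riemann.
have -> : nabla1 G (fun q _ => (q == m)%:R) = (fun a b => - Gam m a b).
  apply/funext => a; apply/funext => b; apply/funext => z.
  rewrite /nabla1 partial_cst sub0r; congr (- _).
  rewrite (bigD1 m) //= eqxx mulr1 big1 ?addr0 // => p /negPf pm.
  by rewrite pm mulr0.
have nabla2E a b c : nabla2 G (fun a b => - Gam m a b) a b c y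
    = - partial a (Gam m b c) y + \sum_p Gam p a b y * Gam m p c y
      + \sum_p Gam p a c y * Gam m b p y.
  have -> : partial a (Gam m b c) y = - partial a (- Gam m b c) y.
    by rewrite partialN ?opprK //; exact: derivable_christoffel.
  rewrite opprK; congr (_ + _ + _).
    by rewrite -sumrN; apply: eq_bigr => p _; rewrite -mulrN opprK.
  by rewrite -sumrN; apply: eq_bigr => p _; rewrite -mulrN opprK.
have torsion : \sum_p Gam p j i y * Gam m p k y
    = \sum_p Gam p i j y * Gam m p k y.
  by apply: eq_bigr => p _; rewrite (christoffel_sym p i j Uy).
have cancel (a b c c' d f : R) : c' = c ->
    - a + c + d - (- b + c' + f) = b - a + d - f by move=> ->; ring.
by rewrite (nabla2E i j k) (nabla2E j i k); exact: cancel torsion.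
Qed.

Lemma riemann_antisym y i j k m : riemann G j i k m y = - riemann G i j k m y.
Proof. by rewrite /riemann [RHS]opprB. Qed.

Lemma riemann_bianchi y i j k m : U y ->
  riemann G i j k m y + riemann G j k i m y + riemann G k i j m y = 0.
Proof.
move=> Uy.
(* D collects the derivatives of the connection, Q its quadratic terms. *)
have [D [Q [DS QS rE]]] : exists D Q : 'I_n -> 'I_n -> 'I_n -> R,
    [/\ forall a b c, D a b c = D a c b, forall a b c, Q a b c = Q b a c &
     forall a b c, riemann G a b c m y = D b a c - D a b c + Q a c b - Q b c a].
  exists (fun a b c => partial a (Gam m b c) y).
  exists (fun a b c => \sum_p Gam p a b y * Gam m c p y); split=> a b c.
  - apply: near_eq_derive; apply: filterS (near_chart Uy) => z.
    exact: christoffel_sym.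
  - by apply: eq_bigr => p _; rewrite (christoffel_sym p a b Uy).
  - exact: riemannE.
rewrite !rE (DS i k j) (DS j k i) (DS k j i) (QS k i) (QS k j) (QS j i); ring.
Qed.

Lemma lower_riemann_skew y i j k l : U y ->
  \sum_m riemann G i j l m y * G y m k = - \sum_m riemann G i j k m y * G y m l.
Proof.
move=> Uy; apply: (@lowered_curvature_skew _ _ (G y)
  (fun m a b => Gam m a b y) (fun m a b => Gam1 m a b y)
  (fun h m a b => partial h (Gam m a b) y) (fun h a b => partial h (g a b) y)
  (fun h k a b => partial h (partial k (g a b)) y)
  (fun i j k m => riemann G i j k m y)).
- by move=> *; exact: metric_entry_sym.
- by move=> *; exact: lower_christoffel.
- by move=> *; exact: partial_metric.
- by move=> *; exact: lower_partial_christoffel.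
- by move=> h p a b; apply: smooth_partialC => //; exact: chart_metric_smooth.
- by move=> *; exact: partial2_metric_sym.
- by move=> *; exact: riemannE.
Qed.

End ChartMetric.

(** * Exterior products of eigenspaces *)

(** P ranges over the tensor product of the two eigenspaces.  Conversely to the
    evident inclusion, a full rank factorization of P writes it as a sum of
    products of a vector in its column space, contained in the first eigenspace,
    and a vector in its row space, contained in the second. *)
Lemma wedge_span_eigenspaceP (R : realType) (n : nat) (S : 'M[R]_n)
    (lambda mu : R) (w : 'M[R]_n) :
  wedge_span (eigenspace S lambda) (eigenspace S mu) w <->
  exists P : 'M[R]_n, [/\ S^T *m P = lambda *: P, P *m S = mu *: P & w = P - P^T].
Proof.
split=> [[N [c [X [Y [XY ->]]]]] | [P [SP PS ->]]].
  exists (\sum_(s < N) c s *: ((X s)^T *m Y s)); split.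
  - rewrite mulmx_sumr scaler_sumr; apply: eq_bigr => s _.
    have [/eigenspaceP XS _] := XY s.
    rewrite -scalemxAr mulmxA -trmx_mul XS linearZ /= -scalemxAl.
    by rewrite scalerA mulrC -scalerA.
  - rewrite mulmx_suml scaler_sumr; apply: eq_bigr => s _.
    have [_ /eigenspaceP YS] := XY s.
    by rewrite -scalemxAl -mulmxA YS -scalemxAr scalerA mulrC -scalerA.
  - rewrite raddf_sum -sumrB /=; apply: eq_bigr => s _.
    by rewrite linearZ /= trmx_mul trmxK -scalerBr.
pose U := col_base P; pose V := row_base P.
have PE : P = U *m V by rewrite mulmx_base.
have [W VW] := row_freeP (row_base_free P).
exists (\rank P), (fun=> 1), (fun s => row s U^T), (fun s => row s V); split.
  move=> s; split.
    apply/(submx_trans (row_sub _ _))/eigenspaceP.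
    have -> : U = P *m W by rewrite -[LHS]mulmx1 -VW mulmxA -PE.
    have PTS : P^T *m S = lambda *: P^T.
      by rewrite -[S]trmxK -trmx_mul SP linearZ.
    by rewrite trmx_mul -mulmxA PTS scalemxAr.
  apply/(submx_trans (row_sub _ _)); rewrite eq_row_base.
  exact/eigenspaceP.
have sumE : P = \sum_s (row s U^T)^T *m row s V.
  by apply/matrixP => i j; rewrite {1}PE mxE summxE; apply: eq_bigr => s _;
     rewrite !mxE big_ord1 !mxE.
rewrite {1 2}sumE raddf_sum -sumrB /=; apply: eq_bigr => s _.
by rewrite scale1r; congr (_ - _); rewrite [LHS]trmx_mul trmxK.
Qed.


(** The linear algebra at the heart of the theorem.  With B = - (A + C), the
    sum of the second and third relations gives C S^T = (lambda + mu) C - S C,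
    and the second alone gives (lambda - mu) A = mu C - S C.  If lambda and mu
    differ, the last relation becomes (S - lambda) (S - mu) C = 0, so that
    Q = - A, which is (S - mu) C divided by lambda - mu, is the component of C in
    the eigenspace of lambda, and antisymmetry of C makes the other component
    - Q^T.  If lambda = mu, then C itself is in the eigenspaces, and Q = C / 2. *)
Lemma eigen_splitting (R : realFieldType) (n : nat) (S A B C : 'M[R]_n)
    (lambda mu : R) :
  C^T = - C -> A + B + C = 0 ->
  lambda *: A + mu *: B + S *m C = 0 ->
  mu *: A + lambda *: B + C *m S^T = 0 ->
  lambda *: C + S *m A + B *m S^T = 0 ->
  exists Q, [/\ S *m Q = lambda *: Q, Q *m S^T = mu *: Q & C = Q - Q^T].
Proof.
move=> CT E0.
have -> : B = - (A + C) by apply/eqP; rewrite -addr_eq0 addrA (addrC B) E0.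
rewrite mulNmx mulmxDl => {B E0} E1 E2 E3.
have CS : C *m S^T = (lambda + mu) *: C - S *m C.
  move: (S *m C) (C *m S^T) E1 E2 => D F E1 E2.
  apply/matrixP => i j.
  move/matrixP/(_ i j): E1; move/matrixP/(_ i j): E2; rewrite !mxE; lra.
have [lm|lm] := eqVneq lambda mu.
  have SC : S *m C = lambda *: C.
    move: (S *m C) E1 => D E1; apply/matrixP => i j.
    by move/matrixP/(_ i j): E1; rewrite !mxE -lm; lra.
  exists (2^-1 *: C); split.
  - by rewrite -scalemxAr SC scalerA mulrC -scalerA.
  - by rewrite -scalemxAl CS SC lm scalerDl addrK scalerA mulrC -scalerA.
  - by rewrite linearZ /= CT scalerN opprK -scalerDl [_ + _](_ : _ = 1) ?scale1r //; field.
have k0 : lambda - mu != 0 by rewrite subr_eq0.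
have kA : (lambda - mu) *: A = mu *: C - S *m C.
  move: (S *m C) E1 => D E1; apply/matrixP => i j.
  by move/matrixP/(_ i j): E1; rewrite !mxE; lra.
have kSA : (lambda - mu) *: (S *m A) = mu *: (S *m C) - S *m (S *m C).
  by rewrite scalemxAr kA mulmxBr -scalemxAr.
have kAS : (lambda - mu) *: (A *m S^T)
    = mu *: (C *m S^T) - ((lambda + mu) *: (S *m C) - S *m (S *m C)).
  by rewrite scalemxAl kA mulmxBl -scalemxAl -mulmxA CS mulmxBr -scalemxAr.
have kAT : (lambda - mu) *: A^T = C *m S^T - mu *: C.
  rewrite -[LHS]linearZ /= kA linearB /= linearZ /= trmx_mul CT.
  rewrite mulNmx scalerN addrC; congr (_ - _).
  by rewrite [LHS]opprK.
rewrite CS in E3 kAS kAT.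
have NAT : (- A)^T = - A^T by apply/matrixP => i j; rewrite !mxE.
exists (- A); rewrite mulmxN mulNmx NAT.
move: (S *m (S *m C)) (S *m C) (S *m A) (A *m S^T) (A^T) E3 kA kSA kAS kAT.
move=> E D SA AS AT E3 kA kSA kAS kAT.
split; apply/matrixP => i j.
all: move/matrixP/(_ i j): E3; move/matrixP/(_ i j): kA.
all: move/matrixP/(_ i j): kSA; move/matrixP/(_ i j): kAS.
all: move/matrixP/(_ i j): kAT; rewrite !mxE.
all: move: (E i j) (D i j) (SA i j) (AS i j) (A i j) (AT i j) (C i j).
all: move=> e d sa as_ a at_ c kat kas ksa ka e3.
all: have {e3} := congr1 ( *%R (lambda - mu)) e3; rewrite mulr0 => e3.
all: have kla := congr1 ( *%R lambda) ka; have kma := congr1 ( *%R mu) ka.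
all: apply: (mulfI k0); lra.
Qed.

(** * Contractions of algebraic curvature tensors *)

Definition contract (R : realType) (n : nat) (P : 'M[R]_n)
    (F : 'I_n -> 'I_n -> R) : R := \sum_i \sum_j P i j * F i j.

Lemma contract_ext (R : realType) (n : nat) (P : 'M[R]_n) F F' :
  (forall i j, F i j = F' i j) -> contract P F = contract P F'.
Proof. by move=> FF; apply: eq_bigr => i _; apply: eq_bigr => j _; rewrite FF. Qed.

Lemma contractD (R : realType) (n : nat) (P : 'M[R]_n) F F' :
  contract P (fun i j => F i j + F' i j) = contract P F + contract P F'.
Proof.
rewrite /contract -big_split; apply: eq_bigr => i _.
by rewrite -big_split; apply: eq_bigr => j _; rewrite mulrDr.
Qed.

Lemma contractN (R : realType) (n : nat) (P : 'M[R]_n) F :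
  contract P (fun i j => - F i j) = - contract P F.
Proof.
rewrite /contract -sumrN; apply: eq_bigr => i _.
by rewrite -sumrN; apply: eq_bigr => j _; rewrite mulrN.
Qed.

Lemma contract0 (R : realType) (n : nat) (P : 'M[R]_n) :
  contract P (fun _ _ => 0) = 0.
Proof. by rewrite /contract !big1 // => i _; rewrite big1 // => j _; rewrite mulr0. Qed.

Lemma contract_sum (R : realType) (n : nat) (P : 'M[R]_n) (c : 'I_n -> R)
    (F : 'I_n -> 'I_n -> 'I_n -> R) :
  contract P (fun i j => \sum_q c q * F q i j) = \sum_q c q * contract P (F q).
Proof.
under [RHS]eq_bigr do rewrite mulr_sumr.
rewrite exchange_big; apply: eq_bigr => i _.
under [RHS]eq_bigr do rewrite mulr_sumr.
rewrite exchange_big; apply: eq_bigr => j _.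
by rewrite mulr_sumr; apply: eq_bigr => q _; rewrite mulrCA.
Qed.

Lemma contract_eigenl (R : realType) (n : nat) (P S : 'M[R]_n) (a : R) F :
  S^T *m P = a *: P ->
  contract P (fun i j => \sum_q S i q * F q j) = a * contract P F.
Proof.
move=> SP; rewrite /contract exchange_big [in RHS]exchange_big mulr_sumr.
apply: eq_bigr => j _; under eq_bigr do rewrite mulr_sumr.
rewrite exchange_big mulr_sumr; apply: eq_bigr => q _ /=.
have /matrixP/(_ q j) := SP; rewrite !mxE => E.
rewrite mulrA -E mulr_suml; apply: eq_bigr => i _; rewrite mxE; ring.
Qed.

Lemma contract_eigenr (R : realType) (n : nat) (P S : 'M[R]_n) (a : R) F :
  P *m S = a *: P ->
  contract P (fun i j => \sum_q S j q * F i q) = a * contract P F.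
Proof.
move=> PS; rewrite /contract mulr_sumr.
apply: eq_bigr => i _; under eq_bigr do rewrite mulr_sumr.
rewrite exchange_big mulr_sumr; apply: eq_bigr => q _ /=.
have /matrixP/(_ i q) := PS; rewrite !mxE => E.
rewrite mulrA -E mulr_suml; apply: eq_bigr => j _; ring.
Qed.

(** The classical octahedron argument: the Bianchi identities for the four cyclic
    shifts of i, j, k, l combine to twice the difference of the two sides. *)
Lemma pair_symmetry (R : realType) (I : Type) (L : I -> I -> I -> I -> R) :
  (forall i j k l, L j i k l = - L i j k l) ->
  (forall i j k l, L i j l k = - L i j k l) ->
  (forall i j k l, L i j k l + L j k i l + L k i j l = 0) ->
  forall i j k l, L i j k l = L k l i j.
Proof.
move=> L12 L34 LB i j k l.
have := LB i j k l; have := LB j k l i; have := LB k l i j; have := LB l i j k.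
rewrite (L12 i k j l) (L34 j k i l) (L34 k l i j) (L12 j l k i) (L34 j l i k).
rewrite (L12 i l k j) (L34 i l j k) (L34 i k j l) (L12 i l j k) (L34 i j k l).
lra.
Qed.

Section Invariance.
Variables (R : realType) (n : nat) (S : 'M[R]_n) (L : 'I_n -> 'I_n -> 'I_n -> 'I_n -> R).
Hypotheses (L12 : forall i j k l, L j i k l = - L i j k l)
  (L34 : forall i j k l, L i j l k = - L i j k l)
  (LB : forall i j k l, L i j k l + L j k i l + L k i j l = 0)
  (LS : forall i j k l, \sum_q S i q * L j k l q + \sum_q S j q * L k i l q
    + \sum_q S k q * L i j l q = 0).

(** The relations required by [eigen_splitting] are the Bianchi identity and the
    compatibility relation LS, contracted against P, with three choices of
    the indices that are permuted cyclically in LS: the contracted pair i, j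
    together with k, the same pair together with l, and i together with k, l.  LS holds when S is obtained from b by
    raising its second index and L is the fully covariant curvature tensor. *)
Lemma contracted_curvature_splitting (P : 'M[R]_n) (lambda mu : R) :
  S^T *m P = lambda *: P -> P *m S = mu *: P ->
  exists Q : 'M[R]_n, [/\ S *m Q = lambda *: Q, Q *m S^T = mu *: Q &
    forall k l, contract P (fun i j => L i j k l) = Q k l - Q l k].
Proof.
move=> SP PS.
have L1234 := pair_symmetry L12 L34 LB.
pose A := \matrix_(k, l) contract P (fun i j => L j k l i).
pose B := \matrix_(k, l) contract P (fun i j => L k i l j).
pose C := \matrix_(k, l) contract P (fun i j => L i j l k).
have [||||| Q [SQ QS CQ]] := @eigen_splitting R n S A B C lambda mu.
- apply/matrixP => k l; rewrite !mxE -contractN.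
  by apply: contract_ext => i j; rewrite L34.
- apply/matrixP => k l; rewrite !mxE -!contractD -[RHS](contract0 P).
  apply: contract_ext => i j; rewrite (L34 j k i l) (L34 k i j l) (L34 i j k l).
  by have := LB i j k l; lra.
- apply/matrixP => k l; rewrite !mxE -[RHS](contract0 P).
  rewrite -(contract_eigenl _ SP) -(contract_eigenr _ PS).
  under eq_bigr do rewrite mxE; rewrite -contract_sum -!contractD.
  by apply: contract_ext => i j; rewrite -[RHS](LS i j k l).
- apply/matrixP => k l; rewrite !mxE -[RHS](contract0 P).
  rewrite -(contract_eigenl _ SP) -(contract_eigenr _ PS).
  under eq_bigr do rewrite !mxE mulrC; rewrite -contract_sum -!contractD.
  apply: contract_ext => i j; have := LS i j l k.
  have -> : \sum_q S i q * L j l k q = - \sum_q S i q * L k q l j.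
    by rewrite -sumrN; apply: eq_bigr => q _; rewrite L1234 L34 mulrN.
  have -> : \sum_q S j q * L l i k q = - \sum_q S j q * L q k l i.
    by rewrite -sumrN; apply: eq_bigr => q _; rewrite L1234 L12 mulrN.
  have -> : \sum_q S l q * L i j k q = - \sum_q S l q * L i j q k.
    by rewrite -sumrN; apply: eq_bigr => q _; rewrite L34 mulrN.
  lra.
- apply/matrixP => k l; rewrite !mxE -[RHS](contract0 P).
  rewrite -(contract_eigenl _ SP).
  under eq_bigr do rewrite mxE.
  under [X in _ + X]eq_bigr do rewrite !mxE mulrC.
  rewrite -!contract_sum -!contractD.
  apply: contract_ext => i j; have := LS i k l j.
  have -> : \sum_q S i q * L k l j q = \sum_q S i q * L q j l k.
    by apply: eq_bigr => q _; rewrite L1234 L12 L34 opprK.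
  have -> : \sum_q S k q * L l i j q = \sum_q S k q * L j q l i.
    by apply: eq_bigr => q _; rewrite L1234.
  have -> : \sum_q S l q * L i k j q = \sum_q S l q * L k i q j.
    by apply: eq_bigr => q _; rewrite L12 L34 opprK.
  lra.
exists (- Q); split.
- by rewrite mulmxN SQ scalerN.
- by rewrite mulNmx QS scalerN.
move=> k l; have /matrixP/(_ k l) := CQ.
rewrite !mxE => E; rewrite opprK addrC -opprB -E -contractN.
by apply: contract_ext => i j; rewrite L34.
Qed.
End Invariance.

(** If w = P - P^T, the matrix in the conclusion is twice the contraction of L
    against P with both indices raised by the inverse metric H.  By
    [contracted_curvature_splitting] it is 2 H (Q - Q^T) H, and since S is
    self-adjoint for G, that is, S^T H = H S, the form Q satisfying
    S Q = lambda Q and Q S^T = mu Q becomes a bivector component H Q H in the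
    tensor product of the two eigenspaces. *)
Lemma curvature_like_invariance (R : realType) (n : nat) (G B : 'M[R]_n)
    (r : 'I_n -> 'I_n -> 'I_n -> 'I_n -> R) (lambda mu : R) (w : 'M[R]_n) :
  let L i j k l := \sum_m r i j k m * G m l in
  let S := B *m invmx G in
  G^T = G -> G \in unitmx -> B^T = B ->
  (forall i j k m, r j i k m = - r i j k m) ->
  (forall i j k m, r i j k m + r j k i m + r k i j m = 0) ->
  (forall i j k l, L i j l k = - L i j k l) ->
  (forall i j k l,
     \sum_m (B i m * r j k l m + B j m * r k i l m + B k m * r i j l m) = 0) ->
  wedge_span (eigenspace S lambda) (eigenspace S mu) w ->
  wedge_span (eigenspace S lambda) (eigenspace S mu)
    (\matrix_(k, l) \sum_i \sum_j
       (\sum_p invmx G k p * r i j p l) * w i j).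
Proof.
move=> L S GT Gu BT r12 rB L34 rcompat /wedge_span_eigenspaceP[P [SP PS ->]].
have L12 i j k l : L j i k l = - L i j k l.
  by rewrite /L -sumrN; apply: eq_bigr => m _; rewrite r12 mulNr.
have LB i j k l : L i j k l + L j k i l + L k i j l = 0.
  rewrite /L -!big_split big1 // => m _ /=.
  by rewrite -!mulrDl rB mul0r.
have Gsym m q : G m q = G q m by rewrite -{1}GT mxE.
have SG : S *m G = B by rewrite /S mulmxKV.
have SL i j k l : \sum_q S i q * L j k l q = \sum_m B i m * r j k l m.
  rewrite /L; under eq_bigr do rewrite mulr_sumr.
  rewrite exchange_big; apply: eq_bigr => m _ /=.
  rewrite -SG mxE mulr_suml; apply: eq_bigr => q _.
  by rewrite Gsym; ring.
have LS i j k l : \sum_q S i q * L j k l q + \sum_q S j q * L k i l q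
    + \sum_q S k q * L i j l q = 0.
  by rewrite !SL -!big_split; exact: rcompat.
have [Q [SQ QS CQ]] := contracted_curvature_splitting L12 L34 LB LS SP PS.
have rL i j p l : r i j p l = \sum_q L i j p q * invmx G q l.
  have -> : r i j p l = (\row_m r i j p m *m G *m invmx G) 0 l.
    by rewrite mulmxK // mxE.
  rewrite mxE; apply: eq_bigr => q _; congr (_ * _).
  by rewrite mxE; apply: eq_bigr => m _; rewrite mxE.
pose H := invmx G.
have HT : H^T = H by rewrite /H trmx_inv GT.
have ST : S^T = H *m B by rewrite /S trmx_mul BT HT.
apply/wedge_span_eigenspaceP; exists (2 *: (H *m Q *m H)); split.
- rewrite -scalemxAr !mulmxA ST -(mulmxA H B) -/S -(mulmxA H S) SQ.
  by rewrite -scalemxAr -scalemxAl scalerA mulrC -scalerA.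
- rewrite -scalemxAl -!mulmxA (mulmxA H B) -ST (mulmxA Q) QS.
  by rewrite -scalemxAl -scalemxAr scalerA mulrC -scalerA.
have -> : (2 *: (H *m Q *m H))^T = 2 *: (H *m Q^T *m H).
  by rewrite linearZ /= !trmx_mul HT mulmxA.
rewrite -scalerBr -mulmxBl -mulmxBr; apply/matrixP => k l; rewrite !mxE.
have T2 (F : 'I_n -> 'I_n -> R) : (forall i j, F j i = - F i j) ->
    \sum_i \sum_j F i j * (P - P^T) i j = 2 * contract P F.
  move=> FN.
  have E : \sum_i \sum_j F i j * P j i = - contract P F.
    rewrite /contract exchange_big -sumrN; apply: eq_bigr => i _.
    by rewrite -sumrN; apply: eq_bigr => j _; rewrite FN; ring.
  have -> : 2 * contract P F
      = contract P F - \sum_i \sum_j F i j * P j i by rewrite E; ring.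
  rewrite /contract -sumrB; apply: eq_bigr => i _.
  by rewrite -sumrB; apply: eq_bigr => j _; rewrite !mxE; ring.
rewrite T2; last first.
  by move=> i j; rewrite -sumrN; apply: eq_bigr => p _; rewrite r12 mulrN.
congr (2 * _); rewrite contract_sum.
under [RHS]eq_bigr do rewrite mxE mulr_suml.
rewrite [RHS]exchange_big; apply: eq_bigr => p _ /=.
under [RHS]eq_bigr do rewrite -mulrA; rewrite -mulr_sumr; congr (_ * _).
under eq_bigr do rewrite !mxE -CQ mulrC; rewrite -contract_sum.
by apply: contract_ext => i j; rewrite rL; apply: eq_bigr => q _; rewrite mulrC.
Qed.

(** * Invariance under the curvature operator *)

Lemma posdef_unitmx (R : realType) (n : nat) (A : 'M[R]_n) :
  (forall v : 'rV[R]_n, v != 0 -> 0 < (v *m A *m v^T) 0 0) -> A \in unitmx.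
Proof.
move=> Apos; rewrite -row_free_unit -kermx_eq0; apply/negPn/negP => /rowV0Pn.
by move=> [v /sub_kermxP vA /Apos]; rewrite vA mul0mx mxE ltxx.
Qed.

Lemma metric_chart_metric (R : realType) (n : nat) (M : manifold R n)
    (g : metric M) (a : chart M) : chart_metric (cimg a) (g a).
Proof.
split=> [|i j|z Uz|z Uz].
- exact: cimg_open.
- exact: comp02_smooth.
- by apply/matrixP => i j; rewrite mxE (@metric_sym _ _ _ g a z Uz).
- exact/posdef_unitmx/metric_pos.
Qed.

Theorem theorem2p3 (R : realType) (n : nat) (n_ge4 : (4 <= n)%N)
  (M : manifold R n) (g : metric M) (b : tensor02 M)
  (b_sym : symmetric02 b) (b_compat : riemann_compatible g b)
  (x : M) (a : chart M) (x_in_a : cdom a x) (lambda mu : R) :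
  let y := ccoord a x in
  let V (nu : R) := eigenspace (mixed02 (g a) (b a) y) nu in
  eigenvalue (mixed02 (g a) (b a) y) lambda ->
  eigenvalue (mixed02 (g a) (b a) y) mu ->
  [set curvature_operator (g a) y w | w in wedge_span (V lambda) (V mu)]
    `<=` wedge_span (V lambda) (V mu).
Proof.
move=> y V _ _ _ [w wV <-].
have Uy : cimg a y by exists x.
have ga := metric_chart_metric g a.
apply: (@curvature_like_invariance _ _ (g a y) (b a y)
  (fun i j k m => riemann (g a) i j k m y)).
- exact: chart_metric_sym ga _ Uy.
- exact: chart_metric_unit ga _ Uy.
- by apply/matrixP => i j; rewrite mxE (b_sym _ _ Uy).
- by move=> *; exact: riemann_antisym.
- by move=> *; exact: riemann_bianchi ga _ _ _ _ _ Uy.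
- by move=> *; exact: lower_riemann_skew ga _ _ _ _ _ Uy.
- exact: b_compat.
- exact: wV.
Qed.
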